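(* Let $f$ be a given continuous function on $[0,2\pi)$, let $I\in\{0,1\}$, let $r\in\{1,2,\dots\}$, let $N=2n+1$ with $n\in\{1,2,\dots\}$, and let the factors $\nu=\{\nu_k(r)\}_{k=1}^{\infty}$ have decreasing order $O(k^{-(1+r)})$. Consider the function $$ST^{(I)}(\nu,r,N,t)=\frac{a_0^{(I)}}{2}+\sum_{k=1}^{n}\frac{1}{H_k^{(I)}(r,N)}\left[a_k^{(I)}C_k(\nu,r,N,t)+b_k^{(I)}S_k(\nu,r,N,t)\right],$$ with $a_k^{(I)},b_k^{(I)},C_k,S_k$ as in the context, where $H_k^{(I)}(r,N)^{-1}$ is a multiplier to be chosen. Then $ST^{(I)}(\nu,r,N,t)$ interpolates the trigonometric polynomial $T_n^{(I)}(t)$ in the nodes of the grid $\Delta_N^{(I)}$ only when the multiplier $H_k^{(I)}(r,N)$ is determined by the formulas $$H_k^{(I)}(r,N)=\nu_k(r)+\sum_{m=1}^{\infty}(-1)^{mI}\left[\nu_{mN+k}(r)+\nu_{mN-k}(r)\right],\qquad k=1,\dots,n.$$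
   Context: Grids: for $N=2n+1$, $n=1,2,\dots$, $\Delta_N^{(0)}=\{t_i^{(0)}\}_{i=1}^N$ with $t_i^{(0)}=\frac{2\pi}{N}(i-1)$, and $\Delta_N^{(1)}=\{t_i^{(1)}\}_{i=1}^N$ with $t_i^{(1)}=\frac{\pi}{N}(2i-1)$. The index $I\in\{0,1\}$ selects the grid. For the given continuous function $f$ on $[0,2\pi)$ put $f_j^{(I)}=f(t_j^{(I)})$ and $$a_k^{(I)}=\frac{2}{N}\sum_{j=1}^N f_j^{(I)}\cos kt_j^{(I)}\ (k=0,1,\dots,n),\qquad b_k^{(I)}=\frac{2}{N}\sum_{j=1}^N f_j^{(I)}\sin kt_j^{(I)}\ (k=1,\dots,n).$$ The trigonometric polynomial interpolating $f$ on $\Delta_N^{(I)}$ is $$T_n^{(I)}(t)=\frac{a_0^{(I)}}{2}+\sum_{k=1}^n\left(a_k^{(I)}\cos kt+b_k^{(I)}\sin kt\right).$$ For $k=1,\dots,n$, $$C_k(\nu,r,N,t)=\nu_k(r)\cos kt+\sum_{m=1}^{\infty}\left[\nu_{mN+k}(r)\cos((mN+k)t)+\nu_{mN-k}(r)\cos((mN-k)t)\right],$$ $$S_k(\nu,r,N,t)=\nu_k(r)\sin kt+\sum_{m=1}^{\infty}\left[\nu_{mN+k}(r)\sin((mN+k)t)-\nu_{mN-k}(r)\sin((mN-k)t)\right].$$ To interpolate in the nodes of $\Delta_N^{(I)}$ means that $ST^{(I)}(\nu,r,N,t_i^{(I)})=T_n^{(I)}(t_i^{(I)})$ for $i=1,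\dots,N$.
   Formalization: For a fixed f the formula for H_k is forced only for those k with a_k or b_k nonzero (for f = 0 any nonzero H_k interpolates); for all k = 1,…,n it is forced when the same H must interpolate for every continuous f. H_k is assumed nonzero, and the converse is also proved. *)

(* Defs.v *)
From mathcomp Require Import all_boot all_order all_algebra.
From mathcomp Require Import all_classical all_reals all_analysis.
Import Order.TTheory GRing.Theory Num.Theory.
Import numFieldNormedType.Exports.

Set Implicit Arguments.
Unset Strict Implicit.
Unset Printing Implicit Defensive.

Local Open Scope classical_set_scope.
Local Open Scope ring_scope.

(* The grid index I ranges over {0,1}, encoded as bool with the usual coercion
   to nat.  Grid points and coefficients are indexed from 1 by natural numbers;
   only 1 <= i <= N, resp. k <= n, is meaningful. *)

Definition grid (R : realType) (I : bool) (N i : nat) : R :=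
  if I then pi / N%:R * (2 * i%:R - 1) else 2 * pi / N%:R * (i%:R - 1).

Definition coefa (R : realType) (I : bool) (N : nat) (f : R -> R) (k : nat) : R :=
  2 / N%:R * \sum_(1 <= j < N.+1) f (grid R I N j) * cos (k%:R * grid R I N j).

Definition coefb (R : realType) (I : bool) (N : nat) (f : R -> R) (k : nat) : R :=
  2 / N%:R * \sum_(1 <= j < N.+1) f (grid R I N j) * sin (k%:R * grid R I N j).

Definition trigT (R : realType) (I : bool) (n N : nat) (f : R -> R) (t : R) : R :=
  coefa I N f 0 / 2 +
  \sum_(1 <= k < n.+1)
    (coefa I N f k * cos (k%:R * t) + coefb I N f k * sin (k%:R * t)).

(* [nu k r] stands for nu_k(r).  The index m * N - k is a truncated subtraction
   of naturals, which is exact since k <= n < N <= m * N. *)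

Definition cosSeries (R : realType) (nu : nat -> nat -> R) (r N k : nat) (t : R) : R :=
  nu k r * cos (k%:R * t) +
  \big[+%R/0]_(1 <= m <oo)
    (nu (m * N + k)%N r * cos ((m * N + k)%N%:R * t) +
     nu (m * N - k)%N r * cos ((m * N - k)%N%:R * t)).

Definition sinSeries (R : realType) (nu : nat -> nat -> R) (r N k : nat) (t : R) : R :=
  nu k r * sin (k%:R * t) +
  \big[+%R/0]_(1 <= m <oo)
    (nu (m * N + k)%N r * sin ((m * N + k)%N%:R * t) -
     nu (m * N - k)%N r * sin ((m * N - k)%N%:R * t)).

Definition splineST (R : realType) (I : bool) (nu : nat -> nat -> R)
    (r n N : nat) (H : nat -> R) (f : R -> R) (t : R) : R :=
  coefa I N f 0 / 2 +
  \sum_(1 <= k < n.+1)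
    1 / H k * (coefa I N f k * cosSeries nu r N k t +
               coefb I N f k * sinSeries nu r N k t).

Definition interpolates (R : realType) (I : bool) (nu : nat -> nat -> R)
    (r n N : nat) (H : nat -> R) (f : R -> R) : Prop :=
  forall i : nat, (1 <= i <= N)%N ->
    splineST I nu r n N H f (grid R I N i) = trigT I n N f (grid R I N i).

Definition multH (R : realType) (I : bool) (nu : nat -> nat -> R)
    (r N k : nat) : R :=
  nu k r +
  \big[+%R/0]_(1 <= m <oo)
    ((-1) ^+ (m * I)%N * (nu (m * N + k)%N r + nu (m * N - k)%N r)).

(* Main.v *)
Require Import Defs.
From mathcomp Require Import all_boot all_order all_algebra.
From mathcomp Require Import all_classical all_reals all_analysis.
From mathcomp Require Import ring lra.
Import Order.TTheory GRing.Theory Num.Theory.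
Import numFieldNormedType.Exports.
Local Open Scope classical_set_scope.
Local Open Scope ring_scope.

(** On a grid of N points the frequencies mN + k and mN - k cannot be told
    apart from k: N times a grid point is a multiple of pi, of the parity of I,
    so cos((mN +- k)t) = (-1)^(mI) cos(kt) and
    sin((mN +- k)t) = +-(-1)^(mI) sin(kt) at every grid point t.  The series
    C_k and S_k therefore collapse there to H'_k cos(kt) and H'_k sin(kt), where
    H'_k is the multiplier [multH] ([cosSeries_grid], [sinSeries_grid]).
    The decay of nu enters only here, through the convergence of H'_k
    ([cvg_series_alias]), without which the common factor could not be taken
    out of the sums.

    Consequently ST - T takes on the grid the values of the trigonometric
    polynomial of degree at most n with coefficients (H'_k / H_k - 1) a_k and
    (H'_k / H_k - 1) b_k.  A trigonometric polynomial of degree at most n that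
    vanishes at the N = 2n + 1 grid points has zero coefficients
    ([trig_poly_grid_eq0]), by discrete orthogonality ([cos_orthogonal]).  So
    interpolation means H_k = H'_k for each k such that a_k or b_k is nonzero
    ([interpolates_iff]).  The function cos(kt) has a_k = 1, so requiring
    interpolation for all continuous f forces H_k = H'_k for every k. *)

(** * Convergence of the series *)

(** The terms are dominated by the telescoping ones
    2C (1/k - 1/(k+1)) = 2C / (k(k+1)). *)
Lemma cvg_series_inv_sqr (R : realType) (u : nat -> R) (C : R) (K : nat) :
  (0 < K)%N -> (forall k, (K <= k)%N -> `|u k| <= C / k%:R ^+ 2) ->
  cvgn (series u).
Proof.
move=> K0 uC; apply: normed_cvg; rewrite /normed_series_of.
rewrite -(is_cvg_series_restrict K (fun k => `|u k|)).
apply: nondecreasing_is_cvgn.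
  apply/nondecreasing_seqP => m; case: (leqP K m) => Km; last first.
    by rewrite /= !big_geq // ltnW.
  by rewrite /= big_nat_recr //= lerDl.
have C0 : 0 <= C.
  have /(le_trans (normr_ge0 _)) := uC K (leqnn K).
  by rewrite pmulr_lge0 // invr_gt0 exprn_gt0 // ltr0n.
exists (2 * C / K%:R) => _ [m _ <-] /=.
case: (leqP K m) => [Km|/ltnW mK]; last first.
  by rewrite big_geq // divr_ge0 ?mulr_ge0.
apply: (@le_trans _ _
    (\sum_(K <= k < m) (- (2 * C / k.+1%:R) - - (2 * C / k%:R)))); last first.
  by rewrite telescope_sumr // opprK addrC gerBl divr_ge0 ?mulr_ge0.
apply: ler_sum_nat => k /andP[Kk _]; apply: (le_trans (uC _ Kk)).
have k1 : 1 <= k%:R :> R by rewrite ler1n (leq_trans K0 Kk).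
rewrite -[k.+1%:R]natr1 -subr_ge0.
have -> : - (2 * C / (k%:R + 1)) - - (2 * C / k%:R) - C / k%:R ^+ 2 =
          C * (k%:R - 1) / (k%:R ^+ 2 * (k%:R + 1)).
  by field; apply/andP; split; lra.
by rewrite divr_ge0 ?mulr_ge0 ?exprn_ge0 //; lra.
Qed.

(** Both indices mN + k and mN - k are at least m because k < N, and r >= 1
    makes the decay at least quadratic; so the terms are O(m^-2). *)
Lemma cvg_series_alias (R : realType) (v : nat -> R) (s : nat -> R) (r N k : nat) :
  (0 < r)%N -> (k < N)%N -> (forall m, `|s m| <= 1) ->
  (v =O_\oo (fun j : nat => (j%:R : R) ^- (1 + r))) ->
  cvgn (fun M => \sum_(1 <= m < M) s m * (v (m * N + k)%N + v (m * N - k)%N)).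
Proof.
move=> r0 kN s1 /eqO_exP[C C0 [K _ vC]].
rewrite (is_cvg_series_restrict 1 (fun m => s m * (v (m * N + k)%N + v (m * N - k)%N))).
have vm j m : (0 < m)%N -> (K <= m)%N -> (m <= j)%N -> `|v j| <= C / m%:R ^+ 2.
  move=> m0 Km mj; have := vC j (leq_trans Km mj); rewrite /= => /le_trans; apply.
  rewrite ler_pM2l // ger0_norm ?invr_ge0 ?exprn_ge0 //.
  rewrite lef_pV2 ?posrE ?exprn_gt0 ?ltr0n ?(leq_trans m0) //.
  rewrite -!natrX ler_nat; apply: leq_trans (_ : j ^ 2 <= _)%N.
    by rewrite leq_exp2r.
  by rewrite leq_pexp2l ?(leq_trans m0 mj) // add1n.
apply: (@cvg_series_inv_sqr _ _ (2 * C) K.+1) => // m Km.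
have m0 : (0 < m)%N by apply: leq_trans Km.
have mN : (m + k <= m * N)%N.
  apply: (@leq_trans (m * k.+1)); last by rewrite leq_mul2l kN orbT.
  by rewrite mulnS leq_add2l leq_pmull.
rewrite normrM (_ : 2 * C / _ = 1 * (C / m%:R ^+ 2 + C / m%:R ^+ 2)); last by ring.
rewrite ler_pM // (le_trans (ler_normD _ _)) // lerD ?vm // ?(ltnW Km) //.
  by rewrite (leq_trans _ (leq_addr _ _)) // (leq_trans _ mN) ?leq_addr.
by rewrite leq_subRL ?(leq_trans _ mN) ?leq_addl // addnC.
Qed.

Lemma cvg_series_multH (R : realType) (I : bool) (nu : nat -> nat -> R)
    (r N k : nat) :
  (0 < r)%N -> (k < N)%N ->
  (fun i : nat => nu i r) =O_\oo (fun i : nat => (i%:R : R) ^- (1 + r)) ->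
  cvgn (fun M => \sum_(1 <= m < M)
    (-1) ^+ (m * I) * (nu (m * N + k)%N r + nu (m * N - k)%N r)).
Proof.
move=> r0 kN hnu.
apply: (@cvg_series_alias _ (fun i => nu i r) (fun m => (-1) ^+ (m * I)) r) => // m.
by rewrite normrX normrN1 expr1n.
Qed.

(** The limit of a divergent sequence is a default value, which multiplication
    by c does not respect; hence the hypothesis on G. *)
Lemma series_factor (R : realType) (F G : nat -> R) (c : R) :
  cvgn (fun M => \sum_(1 <= m < M) G m) ->
  (forall m, (0 < m)%N -> F m = G m * c) ->
  \big[+%R/0]_(1 <= m <oo) F m = (\big[+%R/0]_(1 <= m <oo) G m) * c.
Proof.
move=> cG FG; apply/cvg_lim => //.
rewrite (_ : (fun M => _) = (fun M => (\sum_(1 <= m < M) G m) * c)); last first.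
  apply/funext => M; rewrite big_distrl /=; apply: eq_big_nat => m /andP[m0 _].
  exact: FG.
exact: cvgM cG (cvg_cst c).
Qed.

(** * Aliasing on the grid *)

(** Both grids at once: the points are the multiples of pi/N of the parity of
    the grid index. *)
Lemma gridE (R : realType) (I : bool) (N j : nat) :
  grid R I N j.+1 = pi / N%:R * (2 * j + I)%N%:R.
Proof.
by rewrite /grid natrD natrM -natr1; case: I => /=; ring.
Qed.

Lemma grid_alias (R : realType) (I : bool) (N m j : nat) : (0 < N)%N ->
  (m * N)%N%:R * grid R I N j.+1 = pi *+ (m * (2 * j + I)).
Proof.
move=> N0; rewrite gridE -[in RHS]mulr_natr !natrM; field.
by rewrite pnatr_eq0 -lt0n.
Qed.

Lemma signr_grid (R : realType) (m j : nat) (I : bool) :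
  (-1) ^+ (m * (2 * j + I)) = (-1) ^+ (m * I) :> R.
Proof. by rewrite -signr_odd -[RHS]signr_odd !oddM oddD oddM. Qed.

Lemma cos_aliasD (R : realType) (I : bool) (N m k j : nat) (t := grid R I N j.+1) :
  (0 < N)%N ->
  cos ((m * N + k)%N%:R * t) = (-1) ^+ (m * I) * cos (k%:R * t).
Proof.
move=> N0; rewrite natrD mulrDl grid_alias // addrC (alternatingn (@cosDpi R)).
by rewrite signr_grid.
Qed.

Lemma sin_aliasD (R : realType) (I : bool) (N m k j : nat) (t := grid R I N j.+1) :
  (0 < N)%N ->
  sin ((m * N + k)%N%:R * t) = (-1) ^+ (m * I) * sin (k%:R * t).
Proof.
move=> N0; rewrite natrD mulrDl grid_alias // addrC (alternatingn (@sinDpi R)).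
by rewrite signr_grid.
Qed.

Lemma cos_aliasB (R : realType) (I : bool) (N m k j : nat) (t := grid R I N j.+1) :
  (0 < N)%N -> (k <= m * N)%N ->
  cos ((m * N - k)%N%:R * t) = (-1) ^+ (m * I) * cos (k%:R * t).
Proof.
move=> N0 kN; rewrite natrB // mulrBl grid_alias // addrC (alternatingn (@cosDpi R)).
by rewrite signr_grid cosN.
Qed.

Lemma sin_aliasB (R : realType) (I : bool) (N m k j : nat) (t := grid R I N j.+1) :
  (0 < N)%N -> (k <= m * N)%N ->
  sin ((m * N - k)%N%:R * t) = - ((-1) ^+ (m * I) * sin (k%:R * t)).
Proof.
move=> N0 kN; rewrite natrB // mulrBl grid_alias // addrC (alternatingn (@sinDpi R)).
by rewrite signr_grid sinN mulrN.
Qed.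

(** The aliased series have a common factor at each grid point; the convergent
    series left after taking it out is the multiplier. *)
Lemma cosSeries_grid (R : realType) (I : bool) (nu : nat -> nat -> R)
    (r N k j : nat) (t := grid R I N j.+1) :
  (0 < r)%N -> (k < N)%N ->
  (fun i : nat => nu i r) =O_\oo (fun i : nat => (i%:R : R) ^- (1 + r)) ->
  cosSeries nu r N k t = multH I nu r N k * cos (k%:R * t).
Proof.
move=> r0 kN hnu; have N0 : (0 < N)%N by exact: leq_trans kN.
rewrite /cosSeries /multH mulrDl; congr (_ + _); apply: series_factor => [|m m0].
  exact: (@cvg_series_multH R I nu r N k).
have kmN : (k <= m * N)%N by rewrite (leq_trans (ltnW kN)) // leq_pmull.
by rewrite cos_aliasD // cos_aliasB //; ring.
Qed.

Lemma sinSeries_grid (R : realType) (I : bool) (nu : nat -> nat -> R)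
    (r N k j : nat) (t := grid R I N j.+1) :
  (0 < r)%N -> (k < N)%N ->
  (fun i : nat => nu i r) =O_\oo (fun i : nat => (i%:R : R) ^- (1 + r)) ->
  sinSeries nu r N k t = multH I nu r N k * sin (k%:R * t).
Proof.
move=> r0 kN hnu; have N0 : (0 < N)%N by exact: leq_trans kN.
rewrite /sinSeries /multH mulrDl; congr (_ + _); apply: series_factor => [|m m0].
  exact: (@cvg_series_multH R I nu r N k).
have kmN : (k <= m * N)%N by rewrite (leq_trans (ltnW kN)) // leq_pmull.
by rewrite sin_aliasD // sin_aliasB //; ring.
Qed.

(** * Discrete orthogonality *)

Lemma cosM_cos (R : realType) (x y : R) :
  cos x * cos y = (cos (x - y) + cos (x + y)) / 2.
Proof. by rewrite cosB cosD; field. Qed.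

(** Multiplying by sin(h), with h half of the constant angle between two
    consecutive terms, makes the sum telescope; the two ends differ by m full
    turns.  The bounds on m give 0 < h < pi, so sin(h) can be cancelled.  The
    phase p covers the sine sums as well. *)
Lemma sum_cos_grid (R : realType) (I : bool) (N m : nat) (p : R) : (0 < m < N)%N ->
  \sum_(1 <= j < N.+1) cos (m%:R * grid R I N j + p) = 0.
Proof.
move=> /andP[m0 mN]; have N0 : (0 < N)%N by apply: leq_trans mN.
have NR : N%:R != 0 :> R by rewrite pnatr_eq0 -lt0n.
pose h : R := m%:R * pi / N%:R.
have sh : 0 < sin h.
  rewrite sin_gt0_pi // /h divr_gt0 ?mulr_gt0 ?pi_gt0 ?ltr0n //=.
  by rewrite ltr_pdivrMr ?ltr0n // mulrC ltr_pM2l ?pi_gt0 // ltr_nat.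
apply: (mulfI (lt0r_neq0 sh)); rewrite mulr0 big_add1 /= big_distrr /=.
pose g (j : nat) : R := sin (m%:R * grid R I N j.+1 + p - h) / 2.
transitivity (\sum_(0 <= j < N) (g j.+1 - g j)).
  apply: eq_bigr => j _.
  rewrite /g; set x := m%:R * grid R I N j.+1 + p.
  have -> : m%:R * grid R I N j.+2 + p - h = x + h.
    by rewrite /x /h !gridE ![(2 * _ + I)%N%:R]natrD !natrM -[j.+1%:R]natr1; field.
  by rewrite [sin (x + h)]sinD [sin (x - h)]sinB; field.
rewrite telescope_sumr // /g.
have -> : m%:R * grid R I N N.+1 + p - h =
          m%:R * grid R I N 1 + p - h + pi *+ 2 *+ m.
  rewrite !gridE ![(2 * _ + I)%N%:R]natrD !natrM -[_ *+ m]mulr_natr -[pi *+ 2]mulr_natr.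
  by rewrite /h; field.
by rewrite (periodicn (@sinD2pi R)) subrr.
Qed.

(** The product-to-sum formula leaves the frequencies k + l and k - l, which are
    smaller than N in absolute value as k, l <= n; their sums vanish unless
    k = l.  Since sin(x) = cos(x - pi/2), the phases p and q make this the
    orthogonality of cosines, of sines, and of cosines against sines. *)
Lemma cos_orthogonal (R : realType) (I : bool) (n N k l : nat) (p q : R) :
  N = (2 * n + 1)%N -> (1 <= k <= n)%N -> (1 <= l <= n)%N ->
  \sum_(1 <= j < N.+1)
     cos (k%:R * grid R I N j + p) * cos (l%:R * grid R I N j + q) =
  if k == l then N%:R / 2 * cos (p - q) else 0.
Proof.
move=> NE /andP[k1 kn] /andP[l1 ln].
have klN : (0 < k + l < N)%N.
  by rewrite addn_gt0 k1 NE addn1 ltnS mul2n -addnn leq_add.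
under eq_bigr => j _ do rewrite cosM_cos.
rewrite -big_distrl big_split /=.
rewrite [X in _ + X](_ : _ = 0) ?addr0; last first.
  apply: etrans (@sum_cos_grid R I N (k + l) (p + q) klN).
  by apply: eq_bigr => j _; congr (cos _); rewrite natrD; ring.
have diff a b c : (a < b)%N -> (b <= n)%N ->
    \sum_(1 <= j < N.+1) cos ((b - a)%N%:R * grid R I N j + c) = 0.
  move=> ab bn; apply: sum_cos_grid; rewrite subn_gt0 ab /=.
  rewrite (leq_ltn_trans (leq_subr _ _)) // (leq_ltn_trans bn) //.
  by rewrite NE addn1 ltnS mul2n -addnn leq_addr.
case: ltngtP => [kl|lk|->].
- apply/eqP; rewrite mulf_eq0; apply/orP; left; apply/eqP.
  apply: etrans (diff k l (q - p) kl ln); apply: eq_bigr => j _.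
  by rewrite -cosN; congr (cos _); rewrite natrB ?(ltnW kl) //; ring.
- apply/eqP; rewrite mulf_eq0; apply/orP; left; apply/eqP.
  apply: etrans (diff l k (p - q) lk kn); apply: eq_bigr => j _.
  by congr (cos _); rewrite natrB ?(ltnW lk) //; ring.
- under eq_bigr => j _ do rewrite opprD addrACA subrr add0r.
  by rewrite sumr_const_nat subn1 /= -mulr_natr; ring.
Qed.

(** Pairing the polynomial with cos(lt + q) over the grid isolates
    a_l cos(q) - b_l sin(q); the phases q = 0 and q = -pi/2 give the two
    coefficients. *)
Lemma trig_poly_grid_eq0 (R : realType) (I : bool) (n N : nat) (a b : nat -> R) :
  N = (2 * n + 1)%N ->
  (forall i, (1 <= i <= N)%N ->
     \sum_(1 <= k < n.+1) (a k * cos (k%:R * grid R I N i) +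
                           b k * sin (k%:R * grid R I N i)) = 0) ->
  forall k, (1 <= k <= n)%N -> a k = 0 /\ b k = 0.
Proof.
move=> NE P0 l ln.
have N2 : N%:R / 2 != 0 :> R by rewrite mulf_neq0 ?invr_eq0 // pnatr_eq0 NE addn1.
have moment q : a l * cos q - b l * sin q = 0.
  apply: (mulfI N2); rewrite mulr0.
  transitivity (\sum_(1 <= i < N.+1)
    (\sum_(1 <= k < n.+1) (a k * cos (k%:R * grid R I N i) +
                           b k * sin (k%:R * grid R I N i))) *
    cos (l%:R * grid R I N i + q)); last first.
    by rewrite big_nat; apply: big1 => i iN; rewrite P0 // mul0r.
  under eq_bigr => i _ do rewrite big_distrl /=.
  rewrite exchange_big_nat /=.
  transitivity (\sum_(1 <= k < n.+1)
    if k == l then N%:R / 2 * (a l * cos q - b l * sin q) else 0).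
    rewrite (bigD1_seq l) ?mem_index_iota ?iota_uniq //= eqxx.
    by rewrite big1 ?addr0 // => k /negPf ->.
  apply: eq_big_nat => k kn.
  transitivity (a k * (if k == l then N%:R / 2 * cos (0 - q) else 0) +
                b k * (if k == l then N%:R / 2 * cos (- (pi / 2) - q) else 0)).
    case: eqP => [->|_]; last by rewrite !mulr0 addr0.
    by rewrite -opprD !cosN add0r cosN [pi / 2 + q]addrC cosDpihalf; ring.
  rewrite -!(@cos_orthogonal R I n) // !big_distrr -big_split /=.
  apply: eq_bigr => i _.
  by rewrite addr0 cosBpihalf; ring.
split.
  by have := moment 0; rewrite cos0 sin0 mulr1 mulr0 subr0.
have := moment (- (pi / 2)); rewrite cosN cos_pihalf sinN sin_pihalf.
by rewrite mulr0 mulrN1 opprK add0r.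
Qed.

(** * The interpolation criterion *)

(** The error ST - T agrees on the grid with the trigonometric polynomial of
    coefficients d_k a_k and d_k b_k, where d_k vanishes exactly when H_k is the
    prescribed multiplier. *)
Lemma interpolates_iff {R : realType} {I : bool} {r n N : nat}
    {nu : nat -> nat -> R} {H : nat -> R} (f : R -> R) :
  (0 < r)%N -> N = (2 * n + 1)%N ->
  (fun k : nat => nu k r) =O_\oo (fun k : nat => (k%:R : R) ^- (1 + r)) ->
  (forall k : nat, (1 <= k <= n)%N -> H k != 0) ->
  interpolates I nu r n N H f <->
  forall k : nat, (1 <= k <= n)%N ->
    coefa I N f k != 0 \/ coefb I N f k != 0 -> H k = multH I nu r N k.
Proof.
move=> r0 NE hnu hH; pose d k := multH I nu r N k / H k - 1.
have dP k : (1 <= k <= n)%N -> d k = 0 <-> H k = multH I nu r N k.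
  move=> /hH Hk; rewrite /d; split => [/eqP|<-]; last by rewrite divff // subrr.
  by rewrite subr_eq0 => /eqP/(canRL (divfK Hk)); rewrite mul1r.
have STE i : (1 <= i <= N)%N ->
    splineST I nu r n N H f (grid R I N i) - trigT I n N f (grid R I N i) =
    \sum_(1 <= k < n.+1) (d k * coefa I N f k * cos (k%:R * grid R I N i) +
                          d k * coefb I N f k * sin (k%:R * grid R I N i)).
  case: i => // i _; rewrite /splineST /trigT opprD addrACA subrr add0r -sumrB.
  apply: eq_big_nat => k /andP[k1]; rewrite ltnS => kn.
  have kN : (k < N)%N by rewrite NE addn1 ltnS (leq_trans kn) // leq_pmull.
  rewrite cosSeries_grid // sinSeries_grid // /d.
  by field; rewrite hH ?k1.
split=> [hI k kn ab|hk i iN].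
  apply/dP => //.
  have [|da db] := @trig_poly_grid_eq0 R I n N (fun k => d k * coefa I N f k)
    (fun k => d k * coefb I N f k) NE _ k kn.
    by move=> i iN; rewrite -STE // hI // subrr.
  case: ab => c0; first exact: (mulIf c0 (etrans da (esym (mul0r _)))).
  exact: (mulIf c0 (etrans db (esym (mul0r _)))).
apply/eqP; rewrite -subr_eq0 STE //; apply/eqP.
rewrite big_nat big1 // => k kn.
suff [-> ->] : d k * coefa I N f k = 0 /\ d k * coefb I N f k = 0.
  by rewrite !mul0r addr0.
have [a0|a0] := eqVneq (coefa I N f k) 0; last first.
  by rewrite (dP k kn).2 ?mul0r //; apply: hk => //; left.
have [b0|b0] := eqVneq (coefb I N f k) 0; first by rewrite a0 b0 !mulr0.
by rewrite (dP k kn).2 ?mul0r //; apply: hk => //; right.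
Qed.

Lemma coefa_cos (R : realType) (I : bool) (n N k : nat) :
  N = (2 * n + 1)%N -> (1 <= k <= n)%N ->
  coefa I N (fun t : R => cos (k%:R * t)) k = 1.
Proof.
move=> NE kn; rewrite /coefa.
have := @cos_orthogonal R I n N k k 0 0 NE kn kn.
under eq_bigr => j _ do rewrite addr0.
move=> ->; rewrite eqxx subr0 cos0 mulr1 mulrA mulfVK ?divff //.
by rewrite pnatr_eq0 NE addn1.
Qed.

Theorem theorem1 (R : realType) (I : bool) (r n N : nat)
    (hr : (1 <= r)%N) (hn : (1 <= n)%N) (hN : N = (2 * n + 1)%N)
    (nu : nat -> nat -> R)
    (hnu : (fun k : nat => nu k r) =O_\oo (fun k : nat => (k%:R : R) ^- (1 + r)))
    (H : nat -> R) (hH : forall k : nat, (1 <= k <= n)%N -> H k != 0) :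
  (forall f : R -> R, {within `[0, 2 * pi[, continuous f} ->
     (interpolates I nu r n N H f <->
      forall k : nat, (1 <= k <= n)%N ->
        coefa I N f k != 0 \/ coefb I N f k != 0 -> H k = multH I nu r N k))
  /\
  ((forall f : R -> R, {within `[0, 2 * pi[, continuous f} ->
      interpolates I nu r n N H f) <->
   forall k : nat, (1 <= k <= n)%N -> H k = multH I nu r N k).
Proof.
split=> [f _|]; first exact: interpolates_iff.
split=> [hI k kn|hk f _]; last first.
  by apply/interpolates_iff => // k kn _; exact: hk.
pose f (t : R) := cos (k%:R * t).
have cf : {within `[0, 2 * pi[, continuous f}.
  apply: continuous_subspaceT => t; apply: continuous_comp.
    by apply: continuousM; [exact: cst_continuous|exact: cvg_id].
  exact: continuous_cos.
apply: ((interpolates_iff f hr hN hnu hH).1 (hI f cf) k kn _).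
by left; rewrite (@coefa_cos R I n) // oner_neq0.
Qed.
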